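(* Let $\kappa$ be an algebraically closed field, let $n\geq 1$, and let $\mathrm{GL}_n(\kappa)$ act by conjugation on the nilpotent $n\times n$ matrices over $\kappa$. For a partition $\pi$ of $n$ let $\mathcal{O}(\pi)$ denote the orbit of nilpotent matrices whose Jordan block sizes are the parts of $\pi$. Let $\pi_1$ and $\pi_2$ be any two partitions of $n$ such that $\pi_1$ dominates $\pi_2$. Then $\mathcal{O}(\pi_2)$ is $1$-accessible from $\mathcal{O}(\pi_1)$. Hence, for nilpotent orbits of $\mathrm{GL}_n(\kappa)$, accessibility and $1$-accessibility coincide, and the partial order on nilpotent orbits given by accessibility is the same as the dominance order.
   Context: A cocharacter of a linear algebraic group $G$ is a homomorphism of algebraic groups $\lambda:\mathbb{G}_m\to G$; the set of these is $Y(G)$. If $G$ acts morphically on an affine variety $X$, $x\in X$ and $\lambda\in Y(G)$, we say $\lim_\lambda x=\lim_{a\to 0}\lambda(a)\cdot x$ exists if the morphism $\mathbb{G}_m\to X$, $a\mapsto\lambda(a)\cdot x$, extends to a morphism $\mathbb{A}^1\to X$; the limit is then the image of $0$. An orbit $\mathcal{O}(y)$ is $1$-accessible from $\mathcal{O}(x)$ if there is $\lambda\in Y(G)$ and an element $x'$ of the orbit of $x$ such that $\lim_\lambda x'$ exists and lies in $\mathcal{O}(y)$ (by conjugating $\lambda$ one may equivalently take $x'=x$). $\mathcal{O}(y)$ is accessible from $\mathcal{O}(x)$ if there is a finite chain of orbits from $\mathcal{O}(x)$ to $\mathcal{O}(y)$ in which each orbit is $1$-accessible from the preceding one. A partition $[a_1\geq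 a_2\geq\cdots]$ of $n$ dominates $[b_1\geq b_2\geq\cdots]$ of $n$ if $\sum_{i\leq j}a_i\geq\sum_{i\leq j}b_i$ for all $j$ (partitions padded by zeros). The dominance order on nilpotent orbits is: $\mathcal{O}_2\leq\mathcal{O}_1$ iff $\overline{\mathcal{O}_2}\subseteq\overline{\mathcal{O}_1}$ (Zariski closures); for $\mathrm{GL}_n(\kappa)$ it is known that this matches the dominance order on the labelling partitions. *)

(* Defs.v *)
From HB Require Import structures.
From mathcomp Require Import all_boot all_order all_algebra.
From mathcomp Require Import boolp classical_sets.
From mathcomp Require Import mpoly.

Set Implicit Arguments.
Unset Strict Implicit.
Unset Printing Implicit Defensive.

Import GRing.Theory.
Local Open Scope ring_scope.
Local Open Scope classical_set_scope.

Record int_partition (n : nat) := IntPartition {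
  parts :> seq nat;
  parts_sorted : sorted geq parts;
  parts_gt0 : 0%N \notin parts;
  parts_sum : sumn parts = n }.

Definition dominates (n : nat) (p q : int_partition n) : Prop :=
  forall j : nat, (\sum_(i < j) nth 0 q i <= \sum_(i < j) nth 0 p i)%N.

Section Orbits.
Variables (K : closedFieldType) (n : nat).
Implicit Types (x y g : 'M[K]_n) (O : set 'M[K]_n) (lam : K -> 'M[K]_n).

Definition nilpotent_mx x : Prop := exists k : nat, x ^+ k = 0.

Definition conj_mx g x : 'M[K]_n := g *m x *m invmx g.

Definition conj_orbit x : set 'M[K]_n :=
  [set y | exists2 g, g \in unitmx & y = conj_mx g x].

Definition nilpotent_orbit O : Prop :=
  exists2 x, nilpotent_mx x & O = conj_orbit x.

Definition jordan_block (a : nat) : 'M[K]_a :=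
  \matrix_(i, j) (j == i.+1 :> nat)%:R.

Fixpoint jordan_mx (s : seq nat) : 'M[K]_(sumn s) :=
  if s is a :: s' then block_mx (jordan_block a) 0 0 (jordan_mx s') else 0.

Definition partition_orbit (p : int_partition n) : set 'M[K]_n :=
  conj_orbit (castmx (parts_sum p, parts_sum p) (jordan_mx p)).

(* The regular functions on G_m are the Laurent polynomials, those on A^1 the
   polynomials; as K is algebraically closed, morphisms of varieties are
   identified with the maps they induce on K-points. *)
Definition Gm_regular (f : K -> K) : Prop :=
  exists (p : {poly K}) (k : nat), forall a : K, a != 0 -> f a = p.[a] / a ^+ k.

Definition A1_regular (f : K -> K) : Prop :=
  exists p : {poly K}, forall a : K, f a = p.[a].

(* Only the values of lam on K \ {0} are meaningful. *)
Definition cocharacter lam : Prop :=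
  [/\ forall i j, Gm_regular (fun a => lam a i j),
      forall a : K, a != 0 -> lam a \in unitmx
    & forall a b : K, a != 0 -> b != 0 -> lam (a * b) = lam a *m lam b].

(* "lim_lam x exists and equals y", in the variety of nilpotent matrices. *)
Definition lim_cochar lam x y : Prop :=
  exists phi : K -> 'M[K]_n,
    [/\ forall i j, A1_regular (fun a => phi a i j),
        forall a : K, nilpotent_mx (phi a),
        forall a : K, a != 0 -> phi a = conj_mx (lam a) x
      & phi 0 = y].

(* In [one_accessible O O'] and [accessible O O'], O' is accessible from O. *)
Definition one_accessible O O' : Prop :=
  exists (lam : K -> 'M[K]_n) (x y : 'M[K]_n),
    [/\ cocharacter lam, O x, lim_cochar lam x y & O' y].

Inductive accessible : set 'M[K]_n -> set 'M[K]_n -> Prop :=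
| accessible_refl O : nilpotent_orbit O -> accessible O O
| accessible_step O1 O2 O3 :
    nilpotent_orbit O1 -> one_accessible O1 O2 -> accessible O2 O3 ->
    accessible O1 O3.

Definition zariski_closed (Z : set 'M[K]_n) : Prop :=
  exists I : set {mpoly K[n * n]},
    Z = [set x | forall p, I p -> p.@[mxvec x 0] = 0].

Definition zariski_closure (S : set 'M[K]_n) : set 'M[K]_n :=
  smallest zariski_closed S.

End Orbits.

Arguments partition_orbit K {n} p.

Definition partial_order_on (T : Type) (D : set T) (R : T -> T -> Prop) : Prop :=
  [/\ forall x, D x -> R x x,
      forall x y, D x -> D y -> R x y -> R y x -> x = y
    & forall x y z, D x -> D y -> D z -> R x y -> R y z -> R x z].

(* Main.v *)
(* For row vectors, a nilpotent x stabilising a filtration degenerates, along a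
   diagonal cocharacter whose weights define the filtration, to the associated
   graded endomorphism. So it suffices to find, in a K[t]-module of type pi_1, a
   filtration whose subquotients are cyclic, of lengths the parts of pi_2. If r
   is the smallest part of pi_2 and a >= r >= b are consecutive parts of pi_1
   (possibly b = 0), the submodule generated by v + u t^(a-r) in
   K[t]u + K[t]v = K[t]/t^a + K[t]/t^b is cyclic of length r with cyclic quotient
   of length a + b - r; replacing a, b by a + b - r in pi_1 and deleting r from
   pi_2 preserves dominance, and one concludes by induction.
   Conversely a limit lies in the Zariski closure of the orbit, on which the
   ranks of the powers of x cannot increase, and rank x^k, the sum of the
   (a - k)_+ over the parts a, controls the partial sums: for any j,
   sum_{i<=j} q_i <= sum_i (q_i - k)_+ + j k, with equality at k = q_{j+1}.
   With the Jordan form of nilpotent matrices this closes the cycle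
   dominance => 1-accessibility => accessibility => closure => dominance. *)

Require Import Defs.
From mathcomp Require Import all_boot all_order all_algebra zify.
From mathcomp Require Import boolp classical_sets mpoly.

Set Implicit Arguments.
Unset Strict Implicit.
Unset Printing Implicit Defensive.

Import GRing.Theory.
Local Open Scope ring_scope.
Local Open Scope classical_set_scope.

(** * Similarity and extensions of square matrices *)

Section Similarity.
Variable K : closedFieldType.

(** The two sizes stay separate and the change of basis is rectangular, so that sums bracketed or
    ordered differently are compared without casts. *)
Definition mx_sim m n (x : 'M[K]_m) (y : 'M[K]_n) : Prop :=
  m = n /\ exists (P : 'M[K]_(n, m)) (U : 'M[K]_(m, n)),
    [/\ U *m P = 1%:M, P *m U = 1%:M & P *m x = y *m P].

Definition mx_dsum m n (x : 'M[K]_m) (y : 'M[K]_n) : 'M[K]_(m + n) :=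
  block_mx x 0 0 y.

Lemma mx_simI m n (x : 'M[K]_m) (y : 'M[K]_n) (P : 'M[K]_(n, m)) U :
  m = n -> U *m P = 1%:M -> P *m x = y *m P -> mx_sim x y.
Proof.
move=> emn UP xy; split=> //; exists P, U; split=> //.
by subst n; rewrite (mulmx1C UP).
Qed.

Lemma mx_sim_refl n (x : 'M[K]_n) : mx_sim x x.
Proof. by apply: (@mx_simI _ _ _ _ 1%:M 1%:M); rewrite ?mulmx1 ?mul1mx. Qed.

Lemma mx_sim_sym m n (x : 'M[K]_m) (y : 'M[K]_n) : mx_sim x y -> mx_sim y x.
Proof.
case=> emn [P [U [UP PU xy]]]; apply: (@mx_simI _ _ _ _ U P) => //.
by rewrite -[y]mulmx1 -PU !mulmxA -(mulmxA U) -xy mulmxA UP mul1mx.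
Qed.

Lemma mx_sim_trans m n p (x : 'M[K]_m) (y : 'M[K]_n) (z : 'M[K]_p) :
  mx_sim x y -> mx_sim y z -> mx_sim x z.
Proof.
case=> emn [P [U [UP PU xy]]] [enp [Q [V [VQ QV yz]]]].
apply: (@mx_simI _ _ _ _ (Q *m P) (U *m V)); first by rewrite emn.
  by rewrite mulmxA -(mulmxA U) VQ mulmx1.
by rewrite -mulmxA xy !mulmxA yz.
Qed.

Lemma mx_sim_dim0 m n (x : 'M[K]_m) (y : 'M[K]_n) :
  m = 0%N -> n = 0%N -> mx_sim x y.
Proof.
move=> m0 n0; apply: (@mx_simI _ _ _ _ 0 0); first by rewrite m0.
  by subst m; rewrite [LHS]flatmx0 [RHS]flatmx0.
by rewrite mulmx0 mul0mx.
Qed.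

Lemma mx_sim_cast m n (emn : m = n) (x : 'M[K]_m) :
  mx_sim x (castmx (emn, emn) x).
Proof. by subst n; rewrite castmx_id; apply: mx_sim_refl. Qed.

Lemma mx_sim_exp m n (x : 'M[K]_m) (y : 'M[K]_n) k :
  mx_sim x y -> mx_sim (x ^+ k) (y ^+ k).
Proof.
case=> emn [P [U [UP PU xy]]]; apply: (@mx_simI _ _ _ _ P U) => //.
elim: k => [|k IHk]; first by rewrite !expr0 mulmx1 mul1mx.
by rewrite !exprS -!mulmxE mulmxA xy -mulmxA IHk mulmxA.
Qed.

Lemma mx_sim_rank m n (x : 'M[K]_m) (y : 'M[K]_n) :
  mx_sim x y -> \rank x = \rank y.
Proof.
case=> _ [P [U [UP PU xy]]].
have yE : y = P *m x *m U by rewrite xy -mulmxA PU mulmx1.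
have xE : x = U *m y *m P by rewrite -mulmxA -xy mulmxA UP mul1mx.
apply/eqP; rewrite eqn_leq {1}xE (leq_trans (mxrankM_maxl _ _)) ?mxrankM_maxr //.
by rewrite {1}yE (leq_trans (mxrankM_maxl _ _)) ?mxrankM_maxr.
Qed.

Lemma mx_sim_dsum m n p q (x : 'M[K]_m) (y : 'M[K]_n) (x' : 'M[K]_p)
    (y' : 'M[K]_q) :
  mx_sim x x' -> mx_sim y y' -> mx_sim (mx_dsum x y) (mx_dsum x' y').
Proof.
case=> emp [P [U [UP PU xy]]] [enq [Q [V [VQ QV yz]]]].
apply: (@mx_simI _ _ _ _ (block_mx P 0 0 Q) (block_mx U 0 0 V)).
- by rewrite emp enq.
- by rewrite mulmx_block !mul0mx !mulmx0 !addr0 add0r UP VQ -scalar_mx_block.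
by rewrite !mulmx_block !mul0mx !mulmx0 !addr0 !add0r xy yz.
Qed.

Lemma mx_sim_dsumA m n p (x : 'M[K]_m) (y : 'M[K]_n) (z : 'M[K]_p) :
  mx_sim (mx_dsum (mx_dsum x y) z) (mx_dsum x (mx_dsum y z)).
Proof.
rewrite /mx_dsum -[X in mx_sim _ (block_mx x X _ _)]row_mx0.
rewrite -[X in mx_sim _ (block_mx x _ X _)]col_mx0 block_mxA row_mx0 col_mx0.
exact: mx_sim_cast.
Qed.

Lemma mx_sim_dsum0 n (x : 'M[K]_n) (z : 'M[K]_0) : mx_sim (mx_dsum x z) x.
Proof.
apply: (@mx_simI _ _ _ _ (row_mx 1%:M 0) (col_mx 1%:M 0)).
- by rewrite addn0.
- by rewrite mul_col_row !mul1mx !mul0mx scalar_mx_block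
             [X in _ = block_mx _ _ _ X]flatmx0.
by rewrite mul_row_block mulmx0 mul1mx mulmx0 !mul0mx !addr0 mul_mx_row mulmx1
           mulmx0.
Qed.

(* Row-vector convention: the last [q] coordinates of [block_mx A B 0 R] span a
   stable subspace with action [R] and quotient [A]. *)
Definition mx_ext n p q (x : 'M[K]_n) (A : 'M[K]_p) (R : 'M[K]_q) : Prop :=
  exists B, mx_sim x (block_mx A B 0 R).

(** The rows of [P] and [Q] form a basis; those of [Q] span the stable subspace, and [B] records how
    far the span of [P] is from being stable. *)
Lemma mx_extI n p q (x : 'M[K]_n) (A : 'M[K]_p) (R : 'M[K]_q)
    (P : 'M[K]_(p, n)) (Q : 'M[K]_(q, n)) B :
  n = (p + q)%N -> row_full (col_mx P Q) ->
  P *m x = A *m P + B *m Q -> Q *m x = R *m Q -> mx_ext x A R.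
Proof.
move=> enpq /row_fullP[U UPQ] Px Qx; exists B.
apply: (@mx_simI _ _ _ _ (col_mx P Q) U) => //.
by rewrite mul_col_mx Px Qx mul_block_col mul0mx add0r.
Qed.

Lemma mx_ext_sim n n' p p' q (x : 'M[K]_n) (x' : 'M[K]_n') (A : 'M[K]_p)
    (A' : 'M[K]_p') (R : 'M[K]_q) :
  mx_sim x x' -> mx_sim A A' -> mx_ext x A R -> mx_ext x' A' R.
Proof.
(* A change of basis in the quotient alone affects the corner only through left multiplication by
   [P]. *)
move=> xx' [epp' [P [U [UP PU AA']]]] [B xAR]; exists (P *m B).
apply: mx_sim_trans (mx_sim_trans (mx_sim_sym xx') xAR) _.
apply: (@mx_simI _ _ _ _ (block_mx P 0 0 1%:M) (block_mx U 0 0 1%:M)).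
- by rewrite epp'.
- by rewrite mulmx_block !mul0mx !mulmx0 !addr0 add0r UP mulmx1 -scalar_mx_block.
by rewrite !mulmx_block !mul0mx !mulmx0 !addr0 !add0r AA' !(mulmx1, mul1mx).
Qed.

Lemma mx_sim_dsumC m n (x : 'M[K]_m) (y : 'M[K]_n) :
  mx_sim (mx_dsum x y) (mx_dsum y x).
Proof.
apply: (@mx_simI _ _ _ _ (block_mx 0 1%:M 1%:M 0) (block_mx 0 1%:M 1%:M 0)).
- by rewrite addnC.
- by rewrite mulmx_block !mul0mx !mulmx0 !addr0 !add0r !mulmx1 -scalar_mx_block.
by rewrite !mulmx_block !mul0mx !mulmx0 !addr0 !add0r !(mulmx1, mul1mx).
Qed.

Lemma mx_ext_dsuml n m p q (x : 'M[K]_n) (A : 'M[K]_p) (R : 'M[K]_q)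
    (L : 'M[K]_m) :
  mx_ext x A R -> mx_ext (mx_dsum L x) (mx_dsum L A) R.
Proof.
case=> B xAR; exists (col_mx 0 B).
apply: mx_sim_trans (mx_sim_dsum (mx_sim_refl L) xAR) _.
rewrite /mx_dsum -[X in mx_sim (block_mx L X _ _)]row_mx0.
rewrite -[X in mx_sim (block_mx L _ X _)]col_mx0 block_mxA row_mx0.
exact/mx_sim_sym/mx_sim_cast.
Qed.

Lemma mx_ext_dsumr n m p q (x : 'M[K]_n) (A : 'M[K]_p) (R : 'M[K]_q)
    (L : 'M[K]_m) :
  mx_ext x A R -> mx_ext (mx_dsum x L) (mx_dsum A L) R.
Proof.
move=> /(mx_ext_dsuml L); apply: mx_ext_sim; exact: mx_sim_dsumC.
Qed.

End Similarity.

(** * Jordan blocks *)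

Section JordanBlocks.
Variable K : closedFieldType.
Local Notation J := (jordan_block K).

Lemma mx_dsum_exp m n (x : 'M[K]_m) (y : 'M[K]_n) k :
  mx_dsum x y ^+ k = mx_dsum (x ^+ k) (y ^+ k).
Proof.
elim: k => [|k IHk]; first by rewrite !expr0 /mx_dsum -scalar_mx_block.
rewrite !exprS IHk -!mulmxE /mx_dsum mulmx_block !mul0mx !mulmx0 !addr0 add0r.
by [].
Qed.

Definition krylov_mx n (x : 'M[K]_n) (u : 'rV[K]_n) a : 'M[K]_(a, n) :=
  \matrix_(i < a) (u *m x ^+ i).

Lemma mulmx_exprS n (x : 'M[K]_n) m (u : 'M[K]_(m, n)) k :
  u *m x ^+ k.+1 = u *m x ^+ k *m x.
Proof. by rewrite exprSr -mulmxE mulmxA. Qed.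

Lemma mulmx_exprD n (x : 'M[K]_n) m (u : 'M[K]_(m, n)) k l :
  u *m x ^+ (k + l) = u *m x ^+ k *m x ^+ l.
Proof. by rewrite exprD -mulmxE mulmxA. Qed.

(** Multiplication by [x] shifts the rows, as [J a] does, except that the last row is sent to
    [u x^a]; the column selects that row. *)
Lemma krylov_mxM n (x : 'M[K]_n) (u : 'rV[K]_n) a :
  krylov_mx x u a *m x = J a *m krylov_mx x u a +
    (\col_(i < a) (i.+1 == a)%:R) *m (u *m x ^+ a).
Proof.
apply/row_matrixP => i; rewrite linearD /= !row_mul rowK -mulmx_exprS.
rewrite [row i _ *m krylov_mx _ _ _]mulmx_sum_row.
have -> : row i (\col_(i < a) (i.+1 == a)%:R) = (i.+1 == a)%:R%:M :> 'M[K]_1.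
  by apply/rowP => k; rewrite !mxE ord1 eqxx mulr1n.
rewrite mul_scalar_mx; have [e_a|ne_a] := eqVneq i.+1 a.
  rewrite scale1r big1 ?add0r ?e_a // => k _.
  by rewrite !mxE ltn_eqF ?scale0r //; have := ltn_ord k; lia.
have lt_a : (i.+1 < a)%N by have := ltn_ord i; lia.
rewrite scale0r addr0 (bigD1 (Ordinal lt_a)) //= big1 ?addr0.
  by rewrite !mxE eqxx scale1r rowK.
by move=> k /negPf; rewrite -val_eqE /= !mxE => ->; rewrite scale0r.
Qed.

Lemma krylov_mxM0 n (x : 'M[K]_n) (u : 'rV[K]_n) a :
  u *m x ^+ a = 0 -> krylov_mx x u a *m x = J a *m krylov_mx x u a.
Proof. by move=> u0; rewrite krylov_mxM u0 mulmx0 addr0. Qed.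

(** The cyclic vector of [J a]: its successive images are the standard basis rows. *)
Definition head_row a : 'rV[K]_a := \row_j (j == 0 :> nat)%:R.

Lemma head_row_exp a k : head_row a *m J a ^+ k = \row_j (j == k :> nat)%:R.
Proof.
elim: k => [|k IHk]; first by rewrite mulmx1.
rewrite mulmx_exprS IHk; apply/rowP => j; rewrite !mxE.
have [j_k | ne_j] := eqVneq (j : nat) k.+1.
  have lt_a : (k < a)%N by rewrite (leq_trans _ (ltnW (ltn_ord j))) ?j_k.
  rewrite (bigD1 (Ordinal lt_a)) //= big1 ?addr0.
    by rewrite !mxE j_k !eqxx mulr1.
  by move=> i /negPf; rewrite -val_eqE !mxE /= => ->; rewrite mul0r.
rewrite big1 // => i _; rewrite !mxE.
by have [->|_] := eqVneq (i : nat) k; rewrite ?mul0r // (negPf ne_j) mulr0.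
Qed.

Lemma head_row_exp0 a k : (a <= k)%N -> head_row a *m J a ^+ k = 0.
Proof.
move=> le_ak; rewrite head_row_exp; apply/rowP => j; rewrite !mxE.
by rewrite ltn_eqF // (leq_trans _ le_ak).
Qed.

Lemma krylov_jordan a : krylov_mx (J a) (head_row a) a = 1%:M.
Proof. by apply/matrixP => i j; rewrite mxE head_row_exp !mxE eq_sym. Qed.

(* In [<u> + <v>] with [u], [v] of lengths [a], [b], the vector
   [v + u x^(a-r)] spans a submodule of length [r] modulo which [v] lies
   in [<u>]. *)
Lemma jordan_two_blocks_ext a b r : (b <= r <= a)%N ->
  mx_ext (mx_dsum (J a) (J b)) (J (a + b - r)) (J r).
Proof.
case/andP=> le_br le_ra; set x := mx_dsum _ _; set s := (a + b - r)%N.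
pose u : 'rV[K]_(a + b) := row_mx (head_row a) 0.
pose v : 'rV[K]_(a + b) := row_mx 0 (head_row b).
have uE k : u *m x ^+ k = row_mx (head_row a *m J a ^+ k) 0.
  by rewrite mx_dsum_exp mul_row_block !mulmx0 !mul0mx addr0 addr0.
have vE k : v *m x ^+ k = row_mx 0 (head_row b *m J b ^+ k).
  by rewrite mx_dsum_exp mul_row_block !mulmx0 !mul0mx !add0r.
have u0 k : (a <= k)%N -> u *m x ^+ k = 0.
  by move=> le_ak; rewrite uE head_row_exp0 // row_mx0.
have v0 k : (b <= k)%N -> v *m x ^+ k = 0.
  by move=> le_bk; rewrite vE head_row_exp0 // row_mx0.
pose w := v + u *m x ^+ (a - r).
have wE k : w *m x ^+ k = v *m x ^+ k + u *m x ^+ (a - r + k).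
  by rewrite mulmxDl -mulmx_exprD.
have w0 : w *m x ^+ r = 0 by rewrite wE v0 // u0 ?addr0 // subnK.
have w_sub k : (w *m x ^+ k <= krylov_mx x w r)%MS.
  have [lt_kr|le_rk] := ltnP k r.
    by rewrite (_ : _ *m _ = row (Ordinal lt_kr) (krylov_mx x w r)) ?row_sub ?rowK.
  by rewrite -(subnKC le_rk) mulmx_exprD w0 mul0mx sub0mx.
(* Since [s = a - r + b] and [x^b] kills [v], the vector [u x^s] lies in the submodule generated by
   [w]; so modulo [w] the vector [u] has length at most [s]. *)
have us : u *m x ^+ s = w *m x ^+ b.
  by rewrite wE v0 // add0r; congr (_ *m x ^+ _); lia.
have /submxP[D uD] : (u *m x ^+ s <= krylov_mx x w r)%MS by rewrite us.
apply: (@mx_extI _ _ _ _ _ _ _ (krylov_mx x u s) (krylov_mx x w r)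
          ((\col_(i < s) (i.+1 == s)%:R) *m D)).
- by rewrite subnK // (leq_trans le_ra) ?leq_addr.
(* The iterates of [u] and [v] make up the standard basis, so it suffices that [M] spans them; those
   of [v] are differences of iterates of [w] and [u]. *)
- set M := col_mx _ _.
  have wM k : (w *m x ^+ k <= M)%MS.
    by rewrite (submx_trans (w_sub k)) // -addsmxE addsmxSr.
  have uM k : (u *m x ^+ k <= M)%MS.
    have [lt_ks|le_sk] := ltnP k s; last first.
      by rewrite -(subnKC le_sk) mulmx_exprD us -mulmx_exprD.
    rewrite (submx_trans _ (_ : (krylov_mx x u s <= M)%MS)) //; last first.
      by rewrite -addsmxE addsmxSl.
    by rewrite (_ : _ *m _ = row (Ordinal lt_ks) (krylov_mx x u s)) ?row_sub ?rowK.
  have vM k : (v *m x ^+ k <= M)%MS.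
    have -> : v *m x ^+ k = w *m x ^+ k - u *m x ^+ (a - r + k).
      by rewrite wE addrK.
    by rewrite addmx_sub // eqmx_opp.
  have id_uv : col_mx (krylov_mx x u a) (krylov_mx x v b) = 1%:M.
    rewrite scalar_mx_block -[1%:M in X in block_mx X _ _ _]krylov_jordan.
    rewrite -[1%:M in X in block_mx _ _ _ X]krylov_jordan.
    congr col_mx; apply/row_matrixP => i; rewrite rowK row_row_mx rowK row0.
      by rewrite uE.
    by rewrite vE.
  rewrite -sub1mx -id_uv col_mx_sub; apply/andP.
  by split; apply/row_subP => i; rewrite rowK.
- by rewrite krylov_mxM uD mulmxA.
by rewrite krylov_mxM0.
Qed.

Lemma jordan_block_expE a k i j : (J a ^+ k) i j = (j == (i + k)%N :> nat)%:R.
Proof.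
have rowE' : row i (J a ^+ k) = head_row a *m J a ^+ (i + k).
  rewrite mulmx_exprD -[in LHS](mul1mx (J a ^+ k)) row_mul -krylov_jordan.
  by rewrite rowK.
by have /rowP/(_ j) := rowE'; rewrite head_row_exp !mxE.
Qed.

(** The power factors through dimension [a - k] as [E N], where [E] has a left inverse and [N] a
    right inverse, namely their transposes. *)
Lemma rank_jordan_block_exp a k : \rank (J a ^+ k) = (a - k)%N.
Proof.
pose E : 'M[K]_(a, a - k) := \matrix_(i, l) (i == l :> nat)%:R.
pose N : 'M[K]_(a - k, a) := \matrix_(l, j) (j == (l + k)%N :> nat)%:R.
have JE : J a ^+ k = E *m N.
  apply/matrixP => i j; rewrite jordan_block_expE !mxE.
  have [lt_i|le_i] := ltnP i (a - k).
    rewrite (bigD1 (Ordinal lt_i)) //= big1 ?addr0 => [|l /negPf].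
      by rewrite !mxE eqxx mul1r.
    by rewrite -val_eqE !mxE eq_sym /= => ->; rewrite mul0r.
  rewrite big1 => [|l _]; last first.
    by rewrite !mxE gtn_eqF ?mul0r // (leq_trans (ltn_ord l)).
  by rewrite ltn_eqF //; have := ltn_ord j; lia.
have EE : E^T *m E = 1%:M.
  apply/matrixP => l l'; rewrite !mxE.
  have lt_l : (l < a)%N by have := ltn_ord l; lia.
  rewrite (bigD1 (Ordinal lt_l)) //= big1 ?addr0 => [|i /negPf].
    by rewrite !mxE eqxx mul1r.
  by rewrite -val_eqE !mxE /= => ->; rewrite mul0r.
have NN : N *m N^T = 1%:M.
  apply/matrixP => l l'; rewrite !mxE.
  have lt_l : (l + k < a)%N by have := ltn_ord l; lia.
  rewrite (bigD1 (Ordinal lt_l)) //= big1 ?addr0 => [|i /negPf].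
    by rewrite !mxE eqxx mul1r eqn_add2r.
  by rewrite -val_eqE !mxE /= => ->; rewrite mul0r.
apply/eqP; rewrite eqn_leq {1}JE mulmx_max_rank /=.
rewrite -{1}(mxrank1 K (a - k)) -NN -[X in (\rank (X *m _) <= _)%N]mul1mx -EE.
rewrite -!mulmxA (mulmxA E) -JE.
by rewrite (leq_trans (mxrankM_maxr _ _)) ?mxrankM_maxl.
Qed.

Lemma sumn_subn_size s k : (sumn s <= k)%N -> (\sum_(a <- s) (a - k) = 0)%N.
Proof.
move=> le_sk; rewrite big_seq big1 // => a a_s; apply/eqP; rewrite subn_eq0.
apply: leq_trans le_sk; elim: s a_s => //= b s IHs.
by rewrite inE => /predU1P[->|/IHs le_a]; rewrite ?leq_addr //
  (leq_trans le_a) ?leq_addl.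
Qed.

Lemma rank_jordan_mx_exp s k :
  \rank (jordan_mx K s ^+ k) = (\sum_(a <- s) (a - k))%N.
Proof.
elim: s => [|a s IHs]; first by rewrite big_nil [_ ^+ _]flatmx0 mxrank0.
by rewrite big_cons [jordan_mx _ _]/(mx_dsum _ _) mx_dsum_exp rank_diag_block_mx
           rank_jordan_block_exp IHs.
Qed.

Lemma nilpotent_jordan_mx s : nilpotent_mx (jordan_mx K s).
Proof.
exists (sumn s); apply/eqP.
by rewrite -mxrank_eq0 rank_jordan_mx_exp sumn_subn_size.
Qed.

Lemma nilpotent_mx_sim m n (x : 'M[K]_m) (y : 'M[K]_n) :
  mx_sim x y -> nilpotent_mx x -> nilpotent_mx y.
Proof.
move=> xy [k xk]; exists k; apply/eqP.
by rewrite -mxrank_eq0 -(mx_sim_rank (mx_sim_exp k xy)) xk mxrank0.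
Qed.

Lemma jordan_mx_rcons s r :
  mx_sim (jordan_mx K (rcons s r)) (mx_dsum (jordan_mx K s) (J r)).
Proof.
elim: s => [|a s IHs].
  apply: mx_sim_trans (mx_sim_dsumC _ _); exact: mx_sim_refl.
apply: mx_sim_trans (mx_sim_dsum (mx_sim_refl (J a)) IHs) _.
exact/mx_sim_sym/mx_sim_dsumA.
Qed.

End JordanBlocks.

(** * Jordan form of nilpotent matrices *)

Section NormalForm.
Variable K : closedFieldType.
Local Notation J := (jordan_block K).

Lemma krylov_mx_free n (x : 'M[K]_n) (v : 'rV[K]_n) r :
  x ^+ r.+1 = 0 -> v *m x ^+ r != 0 -> row_free (krylov_mx x v r.+1).
Proof.
move=> xr vr; apply: inj_row_free => u uP0; apply/eqP/contraT => u_neq0.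
have [i ui] : exists i, u 0 i != 0 by apply/rV0Pn.
(* In a linear relation with least nonzero coefficient at [i], multiplying by [x^(r-i)] kills every
   later term and leaves a nonzero multiple of [v x^r]. *)
case: (@arg_minnP _ i (fun k => u 0 k != 0) val ui) => {ui}i ui min_i.
have : u *m krylov_mx x v r.+1 *m x ^+ (r - i) = 0 by rewrite uP0 mul0mx.
rewrite [u *m krylov_mx _ _ _]mulmx_sum_row mulmx_suml.
rewrite (bigD1 i) //= big1 ?addr0 => [|k ne_ki].
  rewrite rowK -scalemxAl -mulmx_exprD subnKC -1?ltnS // => /eqP.
  by rewrite scaler_eq0 (negPf ui) (negPf vr).
have [->|uk] := eqVneq (u 0 k) 0; first by rewrite scale0r mul0mx.
rewrite rowK -scalemxAl -mulmx_exprD (_ : _ + _ = r.+1 + (k - i.+1))%N.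
  by rewrite mulmx_exprD xr mulmx0 mul0mx scaler0.
have := min_i k uk; move: ne_ki; rewrite -val_eqE /=.
by have := ltn_ord i; have := ltn_ord k; lia.
Qed.

(* A cyclic subspace of maximal length has a stable complement: the kernel of
   [C], where [C] is a splitting of [P] commuting with the actions. *)
Lemma nilpotent_split_block n (x : 'M[K]_n) r : x ^+ r.+1 = 0 -> x ^+ r != 0 ->
  exists d (A : 'M[K]_d), mx_sim x (mx_dsum (J r.+1) A).
Proof.
move=> xr1 xr0; have [i0 vr] : exists i, row i (x ^+ r) != 0.
  by apply/existsP; rewrite -negb_forall; apply: contraNN xr0 => /forallP x0;
     apply/eqP/row_matrixP => i; rewrite row0; apply/eqP.
rewrite -[x ^+ r]mul1mx row_mul in vr.
set v := row i0 1%:M in vr; set P := krylov_mx x v r.+1.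
have /row_freeP[C0 PC0] : row_free P by apply: krylov_mx_free.
(* A linear form equal to 1 on [v x^r] and to 0 on the other iterates of [v]. *)
pose c := col ord_max C0.
have vc m : v *m x ^+ m *m c = (m == r)%:R%:M.
  have [lt_m|le_m] := ltnP m r.+1; last first.
    by rewrite -(subnKC le_m) exprD xr1 mul0r mulmx0 mul0mx gtn_eqF ?leq_addr //
               raddf0.
  have -> : v *m x ^+ m = row (Ordinal lt_m) P by rewrite rowK.
  rewrite rowE /c colE -mulmxA (mulmxA P) PC0 mul1mx mul_delta_mx_cond -val_eqE /=.
  by apply/matrixP => i j; rewrite !ord1 mulmxnE !mxE eqxx.
(* The dual Krylov basis: the entries of [P C] are [v x^(i+r-j) c], which is 1 exactly for [i = j],
   and [x] shifts the columns of [C] as [J r.+1] does. *)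
pose C := \matrix_(k < n, j < r.+1) (x ^+ (r - j) *m c) k 0.
have colC j : col j C = x ^+ (r - j) *m c.
  by apply/matrixP => k l; rewrite !mxE ord1.
have PC : P *m C = 1%:M.
  apply/matrixP => i j.
  have -> : (P *m C) i j = (row i P *m col j C) 0 0.
    by rewrite !mxE; apply: eq_bigr => k _; rewrite !mxE.
  rewrite rowK colC mulmxA -mulmx_exprD vc !mxE eqxx mulr1n -val_eqE /=.
  by congr (nat_of_bool _)%:R; have := ltn_ord j; lia.
have xC : x *m C = C *m J r.+1.
  apply/matrixP => k j.
  have -> : (x *m C) k j = (x *m col j C) k 0.
    by rewrite !mxE; apply: eq_bigr => i _; rewrite !mxE.
  rewrite colC mulmxA (_ : x *m _ = x ^+ (r - j).+1); last by rewrite exprS.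
  rewrite [RHS]mxE; have [j0|j_gt0] := posnP j.
    rewrite j0 subn0 xr1 mul0mx mxE big1 // => i _.
    by rewrite [J _ i j]mxE j0 mulr0.
  have lt_j : (j.-1 < r.+1)%N by have := ltn_ord j; lia.
  rewrite (bigD1 (Ordinal lt_j)) //= big1 ?addr0 => [|i /negPf].
    rewrite [J _ _ _]mxE /= prednK // eqxx mulr1 [C _ _]mxE /=.
    by congr ((_ ^+ _ *m c) k 0); have := ltn_ord j; lia.
  rewrite -val_eqE /= [J _ _ _]mxE => ne_ij.
  by rewrite -(prednK j_gt0) eqSS eq_sym ne_ij mulr0.
pose N := row_base (kermx C).
have NC (M : 'M_n) : (M <= N)%MS = (M *m C == 0).
  by rewrite eq_row_base; apply/sub_kermxP/eqP.
have N_C : N *m C = 0 by apply/sub_kermxP; rewrite eq_row_base.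
have /submxP[A NA] : (N *m x <= N)%MS.
  by rewrite eq_row_base; apply/sub_kermxP; rewrite -mulmxA xC mulmxA N_C mul0mx.
have /row_fullP[U UPN] : row_full (col_mx P N).
  (* [C P] is a projection: its image lies in the span of [P], while [1 - C P] is killed by [C]. *)
  rewrite -sub1mx -[1%:M](subrK (C *m P)).
  rewrite addmx_sub //; last first.
    by rewrite (submx_trans (submxMl _ _)) // -addsmxE addsmxSl.
  apply: submx_trans (_ : (N <= _)%MS); last by rewrite -addsmxE addsmxSr.
  by rewrite NC mulmxBl mul1mx -mulmxA PC mulmx1 subrr.
have rankC : \rank C = r.+1.
  apply/eqP; rewrite eqn_leq rank_leq_col -{1}(mxrank1 K r.+1) -PC.
  by rewrite mxrankM_maxr.
exists (\rank (kermx C)), A; apply: (@mx_simI _ _ _ _ _ (col_mx P N) U) => //.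
  by rewrite mxrank_ker rankC subnKC // -rankC rank_leq_row.
rewrite mul_col_mx mul_block_col !mul0mx addr0 add0r NA krylov_mxM0 //.
by rewrite xr1 mulmx0.
Qed.

(** A block whose length is the nilpotency index is split off, and the complement is treated by
    induction on the size. The same power kills the complement, so its parts are no larger, which
    keeps the list sorted. *)
Lemma nilpotent_jordan_form n (x : 'M[K]_n) : nilpotent_mx x ->
  exists s, [/\ sorted geq s, 0%N \notin s & mx_sim x (jordan_mx K s)].
Proof.
elim/ltn_ind: n x => n IHn x nil_x.
have [n0|n_gt0] := posnP n.
  by exists [::]; split=> //; apply: mx_sim_dim0.
have [k xk min_k] : exists2 k, x ^+ k = 0 & forall l, x ^+ l = 0 -> (k <= l)%N.
  have ex_k : exists k, x ^+ k == 0 by case: nil_x => k /eqP; exists k.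
  case: (ex_minnP ex_k) => k /eqP xk min_k; exists k => // l /eqP; exact: min_k.
case: k => [|r] in xk min_k.
  (* Index 0 would make the identity vanish, against [n > 0]. *)
  have := mxrank1 K n; rewrite [1%:M](_ : _ = 0) ?mxrank0 // => n0.
  by rewrite -n0 in n_gt0.
have xr : x ^+ r != 0 by apply/eqP => /min_k; rewrite ltnn.
have [d [A xJA]] := nilpotent_split_block xk xr.
have rankA l : x ^+ l = 0 -> A ^+ l = 0.
  move=> xl; have := mx_sim_rank (mx_sim_exp l xJA).
  rewrite xl mxrank0 mx_dsum_exp rank_diag_block_mx => /esym/eqP.
  by rewrite addn_eq0 !mxrank_eq0 => /andP[_ /eqP].
have lt_dn : (d < n)%N by have [e_n _] := xJA; lia.
have [|s [s_sort s_gt0 As]] := IHn d lt_dn A; first by exists r.+1; apply: rankA.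
exists (r.+1 :: s); split.
- rewrite /= path_sortedE; last by move=> a b c /= le1 le2; apply: leq_trans le2 le1.
  rewrite s_sort andbT; apply/allP => a a_s /=.
  have := rank_jordan_mx_exp K s r.+1.
  rewrite -(mx_sim_rank (mx_sim_exp r.+1 As)) rankA // mxrank0 => /esym/eqP.
  by rewrite sum_nat_seq_eq0 => /allP/(_ a a_s); rewrite subn_eq0.
- by rewrite inE.
exact: mx_sim_trans xJA (mx_sim_dsum (mx_sim_refl _) As).
Qed.

End NormalForm.

(** * Cyclic filtrations *)

Section PartialSums.
Local Open Scope nat_scope.

Definition psum k (s : seq nat) := \sum_(i < k) nth 0 s i.

Lemma psum0 s : psum 0 s = 0.
Proof. exact: big_ord0. Qed.

Lemma psum_nil k : psum k [::] = 0.
Proof. by rewrite /psum big1 // => i _; rewrite nth_nil. Qed.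

Lemma psumS k a s : psum k.+1 (a :: s) = a + psum k s.
Proof. by rewrite /psum big_ord_recl. Qed.

Lemma psum_recr k s : psum k.+1 s = psum k s + nth 0 s k.
Proof. exact: big_ord_recr. Qed.

Lemma psum_oversize k s : size s <= k -> psum k s = sumn s.
Proof.
elim: s k => [|a s IHs] [|k] //=; rewrite ?psum0 ?psum_nil // psumS => le_sk.
by rewrite IHs.
Qed.

Lemma sorted_geq_cons a s : sorted geq (a :: s) = all (geq a) s && sorted geq s.
Proof.
by rewrite /= path_sortedE // => b c d /= le1 le2; apply: leq_trans le2 le1.
Qed.

(* Removes one box from the bottom of each of the first [r] columns of the
   Young diagram. *)
Fixpoint strip_columns r s :=
  match s with
  | [::] => [::]
  | a :: s' =>
    match s' with
    | [::] => [:: a - r]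
    | b :: s'' => if b <= r then (a + b - r) :: s'' else a :: strip_columns r s'
    end
  end.

Arguments strip_columns : simpl never.

Lemma strip_columns1 r a : strip_columns r [:: a] = [:: a - r].
Proof. by []. Qed.

Lemma strip_columns2 r a b s :
  strip_columns r [:: a, b & s] =
  if b <= r then (a + b - r) :: s else a :: strip_columns r (b :: s).
Proof. by []. Qed.

Lemma all_strip_columns r a s :
  r <= head 0 s -> all (geq a) s -> sorted geq s -> all (geq a) (strip_columns r s).
Proof.
elim: s => [|b [|c s] IHs] //.
  by rewrite strip_columns1 /= !andbT => _ le_ba _;
    apply: leq_trans (leq_subr _ _) le_ba.
move=> le_rb all_a /[dup] sbcs; rewrite sorted_geq_cons => /andP[_ scs].
rewrite strip_columns2; move: all_a sbcs => /=.
move=> /and3P[le_ba le_ca le_sa] /andP[le_cb _].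
case: ifP => le_cr /=; first by rewrite le_sa andbT; lia.
by rewrite le_ba IHs //= ?le_ca //; lia.
Qed.

Lemma sorted_strip_columns r s :
  r <= head 0 s -> sorted geq s -> sorted geq (strip_columns r s).
Proof.
elim: s => [|a [|b s] IHs] // le_ra.
rewrite sorted_geq_cons => /andP[all_a sbs]; rewrite strip_columns2.
case: ifP => le_br; rewrite sorted_geq_cons.
  move: sbs; rewrite sorted_geq_cons => /andP[all_b ->]; rewrite andbT.
  by apply: sub_all all_b => c /=; move: le_ra => /=; lia.
have lt_rb : r < b by rewrite ltnNge le_br.
by rewrite all_strip_columns ?IHs //= ltnW.
Qed.

Lemma sumn_strip_columns r s :
  r <= head 0 s -> sumn (strip_columns r s) = sumn s - r.
Proof.
elim: s => [|a [|b s] IHs] //; first by rewrite strip_columns1 /= !addn0.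
rewrite strip_columns2 => /= le_ra; case: ifP => /= le_br; first by lia.
by rewrite IHs /=; lia.
Qed.

(** Before the merged pair nothing changes; from there on, [a + b - r] stands for two parts, whence
    the index shift and the loss of [r]. A last part left alone counts as merged with 0. *)
Lemma psum_strip_columns r s k : r <= head 0 s ->
  psum k (strip_columns r s) = psum k s \/
  psum k.+1 s = psum k (strip_columns r s) + r.
Proof.
elim: s k => [|a [|b s] IHs] [|k] le_ra; rewrite ?psum0 ?psum_nil; try by left.
  by right; rewrite strip_columns1 !psumS !psum_nil; move: le_ra => /=; lia.
rewrite strip_columns2; move: le_ra => /= le_ra; case: ifP => le_br.
  by right; rewrite !psumS; lia.
have [|eS|eS] := IHs k; first by move=> /=; lia.
  by left; rewrite !psumS eS.
by right; rewrite [LHS]psumS eS psumS addnA.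
Qed.

(** Where the partial sums are shifted, dominance at [k.+1] is used: the extra entry of [t] is at
    least [r], the last entry of a decreasing list, which pays for the loss of [r]. Beyond the end
    of [t] that entry is [r] itself or a default 0. *)
Lemma strip_columns_dominates s t r :
    sorted geq (rcons t r) -> r <= head 0 s -> sumn s = sumn (rcons t r) ->
    (forall k, psum k (rcons t r) <= psum k s) ->
  forall k, psum k t <= psum k (strip_columns r s).
Proof.
move=> t_sort le_r est dom k.
have psum_t l : l <= size t -> psum l (rcons t r) = psum l t.
  move=> le_l; apply: eq_bigr => i _; rewrite nth_rcons.
  by rewrite (leq_trans (ltn_ord i)).
have sumnE : sumn (rcons t r) = sumn t + r by rewrite sumn_rcons.
have [le_tk|lt_kt] := leqP (size t) k.
  rewrite psum_oversize //; have [->|eS] := psum_strip_columns k le_r.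
    by apply: leq_trans (dom k); rewrite -(psum_oversize le_tk);
       apply: leq_sum => i _; rewrite nth_rcons; case: ltnP => // le_ti;
       rewrite nth_default.
  have := dom k.+1; rewrite psum_oversize ?size_rcons // sumnE eS; lia.
have [->|eS] := psum_strip_columns k le_r.
  by rewrite -psum_t ?dom // ltnW.
have := dom k.+1; rewrite eS psum_t // psum_recr.
suff : r <= nth 0 t k by lia.
have /allP/(_ r) : all (geq (nth 0 t k)) (drop k.+1 (rcons t r)).
  move: t_sort; rewrite -{1}(cat_take_drop k (rcons t r)) (drop_nth 0);
    last by rewrite size_rcons ltnW.
  rewrite nth_rcons lt_kt => /cat_sorted2[_].
  by rewrite sorted_geq_cons => /andP[].
apply; rewrite drop_rcons // mem_rcons inE eqxx //.
Qed.

End PartialSums.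

(** * Degeneration to the associated graded matrix *)

Section GradedLimit.
Variable K : closedFieldType.
Local Notation J := (jordan_block K).
Local Notation JM := (jordan_mx K).

Lemma jordan_mx_strip_columns r s : s != [::] -> (r <= head 0 s)%N ->
  mx_ext (JM s) (JM (strip_columns r s)) (J r).
Proof.
elim: s => [|a [|b s] IHs] // _ le_ra.
  (* A part with no successor is the two-block case with [b = 0]. *)
  have Asim : mx_sim (J (a + 0 - r)) (JM [:: (a - r)%N]).
    by rewrite addn0; apply/mx_sim_sym/mx_sim_dsum0.
  have := @jordan_two_blocks_ext K a 0 r le_ra; apply: mx_ext_sim Asim.
  apply: mx_sim_dsum; first exact: mx_sim_refl.
  exact: mx_sim_dim0.
rewrite strip_columns2; case: leqP => [le_br|lt_rb]; last first.
  by apply: mx_ext_dsuml; apply: IHs => //=; apply: ltnW.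
have /(mx_ext_dsumr (JM s)) : mx_ext (mx_dsum (J a) (J b)) (J (a + b - r)) (J r).
  by apply: jordan_two_blocks_ext; rewrite le_br.
apply: mx_ext_sim; [exact: mx_sim_dsumA | exact: mx_sim_refl].
Qed.

(* [w] gives the weights of a diagonal cocharacter, under which [y] is the
   limit of [x]. *)
Definition weight_limit n (w : 'I_n -> nat) (x y : 'M[K]_n) : Prop :=
  (forall i j, (w i < w j)%N -> x i j = 0) /\
  (forall i j, y i j = if w i == w j then x i j else 0).

(** Induction on [t] from its smallest part [r]: a cyclic submodule of length [r] is split off, and
    the quotient, of type [strip_columns r s], still dominates the rest of [t]. *)
Lemma weight_limit_jordan s t :
    sorted geq s -> sorted geq t -> (0 \notin t)%N -> sumn s = sumn t ->
    (forall k, (psum k t <= psum k s)%N) ->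
  exists n (w : 'I_n -> nat) (x y : 'M[K]_n),
    [/\ mx_sim x (JM s), mx_sim y (JM t) & weight_limit w x y].
Proof.
elim/last_ind: t s => [|t r IHt] s s_sort t_sort t_gt0 est dom.
  exists 0%N, (fun=> 0%N), 0, 0; split; try exact: mx_sim_dim0.
  by split=> [[]|[]].
have r_gt0 : (0 < r)%N.
  by rewrite lt0n; apply: contraNneq t_gt0 => ->; rewrite mem_rcons inE eqxx.
(* [r] is at most the largest part of [rcons t r], which dominance at index 1 bounds by the largest
   part of [s]. *)
have le_r : (r <= head 0 s)%N.
  have := dom 1%N; rewrite !psum_recr !psum0 !add0n nth0; apply: leq_trans.
  case: t {IHt t_gt0 est dom} t_sort => //= a t; rewrite path_sortedE.
    by case/andP=> /allP/(_ r); rewrite mem_rcons inE eqxx => /(_ isT).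
  by move=> b c d /= le1 le2; apply: leq_trans le2 le1.
have s_neq0 : s != [::].
  by apply: contraTneq r_gt0 => s0; move: le_r; rewrite s0 leqn0 => /eqP->.
have [|||||n [w [x [y [xs yt [wx wy]]]]]] := IHt (strip_columns r s).
- exact: sorted_strip_columns.
- by move: t_sort; rewrite -cats1 => /cat_sorted2[].
- by apply: contraNN t_gt0; rewrite mem_rcons inE orbC => ->.
- by rewrite sumn_strip_columns // est sumn_rcons addnK.
- exact: strip_columns_dominates.
have [B sB] := mx_ext_sim (mx_sim_refl _) (mx_sim_sym xs)
                 (jordan_mx_strip_columns s_neq0 le_r).
(* The submodule gets weight 0 and all weights of the quotient rise by one. Rows of [B] then weigh
   more than its columns, so [B] disappears in the limit; the opposite block must vanish, and
   does. *)
exists (n + r)%N, (fun i => if split i is inl k then (w k).+1 else 0%N),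
  (block_mx x B 0 (J r)), (block_mx y 0 0 (J r)); split.
- exact: mx_sim_sym.
- apply: mx_sim_trans (mx_sim_dsum yt (mx_sim_refl _)) _.
  exact/mx_sim_sym/jordan_mx_rcons.
split=> i j; rewrite !mxE.
  by case: (split i) => k; rewrite !mxE; case: (split j) => l //;
    [exact: wx | rewrite mxE].
by case: (split i) => k; rewrite !mxE; case: (split j) => l; rewrite ?mxE // eqSS.
Qed.

End GradedLimit.

(** * Accessibility and closures *)

Section Dominance.
Local Open Scope nat_scope.

Lemma psum_leq_truncation j k s : psum j s <= \sum_(a <- s) (a - k) + j * k.
Proof.
elim: s j => [|a s IHs] [|j]; rewrite ?psum0 ?psum_nil // psumS big_cons mulSn.
by have := IHs j; lia.
Qed.

(** With the entry at index [j] as threshold, earlier parts are at least the threshold and later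
    ones contribute nothing. *)
Lemma truncation_leq_psum j s : sorted geq s ->
  \sum_(a <- s) (a - nth 0 s j) + j * nth 0 s j <= psum j s.
Proof.
elim: s j => [|a s IHs] j; first by rewrite big_nil nth_nil muln0.
rewrite sorted_geq_cons => /andP[/allP le_sa s_sort]; case: j => [|j] /=.
  rewrite psum0 mul0n addn0 big_cons subnn add0n big_seq big1 // => b /le_sa.
  by move=> le_ba; apply/eqP; rewrite subn_eq0.
rewrite psumS big_cons mulSn; have := IHs j s_sort.
suff : nth 0 s j <= a by lia.
have [lt_js|le_sj] := ltnP j (size s); last by rewrite nth_default.
exact/le_sa/mem_nth.
Qed.

(** The hypothesis is applied at [k = nth 0 p j], where the truncation bound on the partial sum of
    [p] is attained. *)
Lemma dominates_truncation n (p q : int_partition n) :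
    (forall k, \sum_(a <- q) (a - k) <= \sum_(a <- p) (a - k)) ->
  dominates p q.
Proof.
move=> le_qp j; apply: leq_trans (truncation_leq_psum j (parts_sorted p)).
by apply: leq_trans (psum_leq_truncation j (nth 0 p j) q) _; rewrite leq_add2r.
Qed.

Lemma dominates_anti n (p q : int_partition n) :
  dominates p q -> dominates q p -> parts p = parts q.
Proof.
move=> pq qp; have eq_nth j : nth 0 p j = nth 0 q j.
  have eq_psum k : psum k p = psum k q.
    by apply/eqP; rewrite eqn_leq [_ <= _]qp [_ <= _]pq.
  by have := eq_psum j.+1; rewrite !psum_recr eq_psum => /addnI.
(* Equal padded entries force equal lengths: otherwise the default 0 would be a part of the longer
   list. *)
have size_leq (r s : int_partition n) :
    (forall j, nth 0 r j = nth 0 s j) -> size s <= size r.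
  move=> eq_rs; rewrite leqNgt; apply/negP => lt_rs.
  by have := parts_gt0 s; rewrite -(nth_default 0 (leqnn (size r))) eq_rs mem_nth.
by apply: (@eq_from_nth _ 0) => //; apply/eqP; rewrite eqn_leq !size_leq.
Qed.

End Dominance.

(** * Orbits, limits along cocharacters and Zariski closures *)

Section Accessibility.
Variables (K : closedFieldType) (n : nat).
Implicit Types (x y g : 'M[K]_n) (O : set 'M[K]_n).

Lemma conj_orbitP x y : conj_orbit x y <-> mx_sim x y.
Proof.
split=> [[g g_unit ->]|[_ [P [U [UP PU xy]]]]].
  apply: (@mx_simI _ _ _ _ _ g (invmx g)); rewrite ?mulVmx //.
  by rewrite /conj_mx mulmxKV.
have P_unit : P \in unitmx by case/mulmx1_unit: PU.
by exists P; rewrite // /conj_mx xy mulmxK.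
Qed.

Lemma conj_mx_sim g x : g \in unitmx -> mx_sim x (conj_mx g x).
Proof. by move=> g_unit; apply/conj_orbitP; exists g. Qed.

Lemma partition_orbitP (p : int_partition n) y :
  partition_orbit K p y <-> mx_sim (jordan_mx K p) y.
Proof.
split=> [/conj_orbitP|py]; first exact/mx_sim_trans/mx_sim_cast.
exact/conj_orbitP/(mx_sim_trans (mx_sim_sym (mx_sim_cast _ _))).
Qed.

Lemma eq_partition_orbit (p q : int_partition n) :
  parts p = parts q -> partition_orbit K p = partition_orbit K q.
Proof.
by move=> pq; apply/seteqP; split=> y /partition_orbitP py; apply/partition_orbitP;
   rewrite ?pq // -pq.
Qed.

Lemma nilpotent_partition_orbit (p : int_partition n) :
  nilpotent_orbit (partition_orbit K p).
Proof.
exists (castmx (parts_sum p, parts_sum p) (jordan_mx K p)) => //.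
apply: nilpotent_mx_sim (nilpotent_jordan_mx K p); exact: mx_sim_cast.
Qed.

Lemma nilpotent_orbit_partition O :
  nilpotent_orbit O -> exists p : int_partition n, O = partition_orbit K p.
Proof.
case=> x /nilpotent_jordan_form[s [s_sort s_gt0 xs]] ->.
have sum_s : sumn s = n by case: xs.
exists (IntPartition s_sort s_gt0 sum_s).
apply/seteqP; split=> y.
  move/conj_orbitP=> xy; apply/partition_orbitP.
  exact: mx_sim_trans (mx_sim_sym xs) xy.
by move=> /partition_orbitP sy; apply/conj_orbitP/(mx_sim_trans xs).
Qed.

Lemma cocharacter_diag (w : 'I_n -> nat) :
  cocharacter (fun a : K => diag_mx (\row_i a ^+ w i)).
Proof.
split=> [i j|a a0|a b _ _].
- exists ((i == j)%:R *: 'X^(w j)), 0%N => a _.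
  rewrite !mxE !hornerE expr0 divr1.
  by have [->|_] := eqVneq i j; rewrite ?mul1r ?mul0r.
- rewrite unitmxE det_diag unitfE; apply/prodf_neq0 => i _.
  by rewrite mxE expf_neq0.
rewrite mulmx_diag; congr diag_mx; apply/rowP => i.
by rewrite !mxE exprMn.
Qed.

Lemma weight_limit_lim (w : 'I_n -> nat) x y :
    nilpotent_mx x -> nilpotent_mx y -> weight_limit w x y ->
  lim_cochar (fun a : K => diag_mx (\row_i a ^+ w i)) x y.
Proof.
move=> nil_x nil_y [wx wy].
(* Conjugation scales the entry by [a^(w i - w j)]. Truncated subtraction is harmless, as the entry
   is 0 when [w i < w j]; at [a = 0] only equal weights survive, since [0^0 = 1]. *)
pose phi a : 'M[K]_n := \matrix_(i, j) (x i j * a ^+ (w i - w j)).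
have phi0 : phi 0 = y.
  apply/matrixP => i j; rewrite wy mxE expr0n subn_eq0.
  by case: ltngtP => [/wx->||]; rewrite ?mul0r ?mulr0 ?mulr1.
have phiE a : a != 0 -> phi a = conj_mx (diag_mx (\row_i a ^+ w i)) x.
  move=> a0; have [_ /(_ a a0) a_unit _] := cocharacter_diag w.
  rewrite /conj_mx -[LHS](mulmxK a_unit); congr (_ *m _).
  apply/matrixP => i j; rewrite mul_mx_diag mul_diag_mx !mxE mulrC.
  have [/wx->|le_w] := ltnP (w i) (w j); first by rewrite mul0r !mulr0.
  by rewrite mulrCA -exprD subnKC // mulrC.
exists phi; split=> // [i j|a].
  exists (x i j *: 'X^(w i - w j)) => a.
  by rewrite mxE hornerZ hornerXn.
have [->|a0] := eqVneq a 0; first by rewrite phi0.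
have [_ /(_ a a0) a_unit _] := cocharacter_diag w.
by rewrite phiE //; apply: nilpotent_mx_sim nil_x; apply: conj_mx_sim.
Qed.

Lemma dominates_one_accessible (p q : int_partition n) :
  dominates p q -> one_accessible (partition_orbit K p) (partition_orbit K q).
Proof.
move=> pq; have [||m [w [x [y [xp yq xy]]]]] :=
  @weight_limit_jordan K p q (parts_sorted p) (parts_sorted q) (parts_gt0 q).
- by rewrite !parts_sum.
- exact: pq.
have enm : m = n by have [em _] := xp; rewrite em parts_sum.
subst m; exists (fun a => diag_mx (\row_i a ^+ w i)), x, y; split.
- exact: cocharacter_diag.
- exact/partition_orbitP/mx_sim_sym.
- apply: weight_limit_lim xy.
    exact: nilpotent_mx_sim (mx_sim_sym xp) (nilpotent_jordan_mx K p).
  exact: nilpotent_mx_sim (mx_sim_sym yq) (nilpotent_jordan_mx K q).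
exact/partition_orbitP/mx_sim_sym.
Qed.

Lemma poly_vanish0 (q : {poly K}) : (forall a, a != 0 -> q.[a] = 0) -> q.[0] = 0.
Proof.
move=> q0; suff -> : q = 0 by rewrite horner0.
(* [q * 'X] vanishes on all of [K], while over an algebraically closed field a nonzero polynomial
   has a nonroot. *)
apply/eqP; have : q * 'X == 0.
  apply/contraT => /closed_nonrootP[a]; rewrite /root hornerM hornerX.
  by have [->|/q0->] := eqVneq a 0; rewrite ?mulr0 ?mul0r eqxx.
by rewrite mulf_eq0 polyX_eq0 orbF.
Qed.

(** Each defining equation, pulled back to the curve, is a polynomial [q] in the parameter;
    vanishing away from 0, it vanishes at 0. *)
Lemma zariski_closed_curve (M : 'M[{poly K}]_n) (Z : set 'M[K]_n) :
    zariski_closed Z ->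
    (forall a, a != 0 -> Z (map_mx (horner_eval a) M)) ->
  Z (map_mx (horner_eval 0) M).
Proof.
case=> I -> MZ p Ip.
pose q := \sum_(m <- msupp p) (p@_m)%:P * \prod_i mxvec M 0 i ^+ m i.
have qE a : p.@[mxvec (map_mx (horner_eval a) M) 0] = q.[a].
  rewrite mevalE horner_sum; apply: eq_bigr => m _.
  rewrite hornerM hornerC horner_prod; congr (_ * _); apply: eq_bigr => i _.
  by rewrite -map_mxvec mxE horner_exp.
by rewrite qE; apply: poly_vanish0 => a /MZ/(_ p Ip); rewrite qE.
Qed.

Lemma regular_curve (phi : K -> 'M[K]_n) :
    (forall i j, A1_regular (fun a => phi a i j)) ->
  exists M : 'M[{poly K}]_n, forall a, phi a = map_mx (horner_eval a) M.
Proof.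
move=> phiP; exists (\matrix_(i, j) sval (cid (phiP i j))) => a.
by apply/matrixP => i j; rewrite !mxE; case: cid.
Qed.

Lemma one_accessible_closure O1 O2 :
    nilpotent_orbit O1 -> nilpotent_orbit O2 -> one_accessible O1 O2 ->
  O2 `<=` zariski_closure O1.
Proof.
move=> [x0 _ ->] [y0 _ ->] [lam [x [y [[_ lam_unit _]]]]].
move=> /conj_orbitP x0x [phi [/regular_curve[M phiE] _ phi_conj phi0]] /conj_orbitP y0y.
move=> z /conj_orbitP y0z Z [Z_closed O1Z].
have /conj_orbitP[g g_unit zE] : mx_sim y z.
  by apply: mx_sim_trans y0z; apply: mx_sim_sym.
(* Conjugating the whole curve by the constant [g] moves its limit [y] to the given point [z] and
   keeps the rest in [O1]. *)
pose M' := map_mx polyC g *m M *m map_mx polyC (invmx g).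
have M'E a : map_mx (horner_eval a) M' = conj_mx g (phi a).
  rewrite !map_mxM -phiE -!map_mx_comp /conj_mx.
  by congr (_ *m _ *m _); apply/matrixP => i j; rewrite !mxE /= horner_evalE hornerC.
rewrite zE -phi0 -M'E; apply: zariski_closed_curve => // a a0.
rewrite M'E phi_conj //; apply/O1Z/conj_orbitP/(mx_sim_trans x0x).
exact: mx_sim_trans (conj_mx_sim _ (lam_unit a a0)) (conj_mx_sim _ g_unit).
Qed.

Lemma zariski_closure_sub O1 O2 :
  O2 `<=` zariski_closure O1 -> zariski_closure O2 `<=` zariski_closure O1.
Proof.
move=> O21 z O2z Z [Z_closed O1Z]; apply: O2z; split=> // y /O21; exact.
Qed.

Lemma sub_zariski_closure O : O `<=` zariski_closure O.
Proof. by move=> z Oz Z [_]; apply. Qed.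

(** Evaluated at the matrix [X] of indeterminates, this determinant is a polynomial in the entries.
    Such generalised minors detect rank. *)
Lemma zariski_closed_det_exp r (U : 'M[K]_(r, n)) (V : 'M[K]_(n, r)) k :
  zariski_closed [set z : 'M[K]_n | \det (U *m z ^+ k *m V) = 0].
Proof.
pose X : 'M[{mpoly K[n * n]}]_n := \matrix_(i, j) 'X_(mxvec_index i j).
pose q := \det (map_mx (@mpolyC _ K) U *m X ^+ k *m map_mx (@mpolyC _ K) V).
have qE z : q.@[mxvec z 0] = \det (U *m z ^+ k *m V).
  have evC m m' (A : 'M[K]_(m, m')) :
      map_mx (meval (mxvec z 0)) (map_mx (@mpolyC _ K) A) = A.
    by apply/matrixP => i j; rewrite !mxE mevalC.
  have evX : map_mx (meval (mxvec z 0)) (X ^+ k) = z ^+ k.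
    elim: k {q} => [|k IHk]; first by rewrite !expr0 map_mx1.
    rewrite !exprS -!mulmxE map_mxM IHk; congr (_ *m _).
    by apply/matrixP => i j; rewrite !mxE /= mevalXU mxvecE.
  by rewrite -det_map_mx !map_mxM !evC evX.
exists [set q]; apply/seteqP; split=> z /=.
  by move=> z0 p ->; rewrite qE.
by move/(_ q erefl); rewrite qE.
Qed.

Lemma zariski_closure_rank x y k :
  zariski_closure (conj_orbit x) y -> (\rank (y ^+ k) <= \rank (x ^+ k))%N.
Proof.
move=> xy; rewrite leqNgt; apply/negP => lt_rank.
(* With [r] the rank of [y^k], these choices give [U y^k V = 1], whereas on the orbit of [x] the
   rank is below [r] and the determinant is 0. *)
have /row_fullP[U UB] := col_base_full (y ^+ k).
have /row_freeP[V BV] := row_base_free (y ^+ k).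
have : \det (U *m y ^+ k *m V) = 0.
  apply: (xy [set z | \det (U *m z ^+ k *m V) = 0]); split.
    exact: zariski_closed_det_exp.
  move=> z /conj_orbitP /(mx_sim_exp k)/mx_sim_rank xz /=.
  apply/eqP; rewrite -[_ == 0]negbK -unitfE -unitmxE -row_free_unit.
  rewrite -row_leq_rank -ltnNge; apply: leq_ltn_trans lt_rank.
  by rewrite xz (leq_trans (mxrankM_maxl _ _)) ?mxrankM_maxr.
suff -> : U *m y ^+ k *m V = 1%:M.
  by rewrite det1; apply/eqP; rewrite oner_eq0.
transitivity (U *m (col_base (y ^+ k) *m row_base (y ^+ k)) *m V).
  by rewrite mulmx_base.
by rewrite mulmxA UB mul1mx.
Qed.

Lemma closure_dominates (p q : int_partition n) :
    zariski_closure (partition_orbit K q) `<=`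
      zariski_closure (partition_orbit K p) ->
  dominates p q.
Proof.
move=> qp; apply: dominates_truncation => k; rewrite -!(rank_jordan_mx_exp K).
have cast (s : int_partition n) :=
  mx_sim_rank (mx_sim_exp k (mx_sim_cast (parts_sum s) (jordan_mx K s))).
rewrite !cast; apply: zariski_closure_rank; apply: qp.
by apply: sub_zariski_closure; apply/partition_orbitP/mx_sim_cast.
Qed.

Lemma accessible_nilpotent O1 O2 :
  accessible O1 O2 -> nilpotent_orbit O1 /\ nilpotent_orbit O2.
Proof. by elim=> [//|O O' O'' nilO _ _ []]. Qed.

Lemma accessible_closure O1 O2 :
  accessible O1 O2 -> zariski_closure O2 `<=` zariski_closure O1.
Proof.
elim=> [O _ z //|O O' O'' nilO OO' /accessible_nilpotent[nilO' _] sub].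
apply: subset_trans sub _; apply: zariski_closure_sub.
exact: one_accessible_closure.
Qed.

Lemma one_accessible_accessible O1 O2 :
  nilpotent_orbit O1 -> nilpotent_orbit O2 -> one_accessible O1 O2 ->
  accessible O1 O2.
Proof.
move=> nil1 nil2 acc12; apply: accessible_step nil1 acc12 _.
exact: accessible_refl.
Qed.

Lemma accessible_trans O1 O2 O3 :
  accessible O1 O2 -> accessible O2 O3 -> accessible O1 O3.
Proof.
by elim=> [//|O O' O'' nilO OO' _ IH acc]; apply: accessible_step OO' (IH acc).
Qed.

Lemma accessible_dominates (p q : int_partition n) :
  accessible (partition_orbit K p) (partition_orbit K q) -> dominates p q.
Proof. by move/accessible_closure/closure_dominates. Qed.

(** Through Jordan types, closure inclusion becomes dominance, which a single cocharacter realises;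
    this is what shortens a chain to one step. *)
Lemma closure_one_accessible O1 O2 :
    nilpotent_orbit O1 -> nilpotent_orbit O2 ->
    zariski_closure O2 `<=` zariski_closure O1 ->
  one_accessible O1 O2.
Proof.
move=> /nilpotent_orbit_partition[p ->] /nilpotent_orbit_partition[q ->].
by move/closure_dominates/dominates_one_accessible.
Qed.

Lemma accessible_anti O1 O2 :
  accessible O1 O2 -> accessible O2 O1 -> O1 = O2.
Proof.
move=> acc12; have [] := accessible_nilpotent acc12.
move=> /nilpotent_orbit_partition[p pE] /nilpotent_orbit_partition[q qE].
rewrite {}pE {}qE in acc12 * => acc21.
by apply: eq_partition_orbit; apply: dominates_anti; apply: accessible_dominates.
Qed.

End Accessibility.

Theorem theorem3p4 (K : closedFieldType) (n : nat) (hn : (1 <= n)%N) :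
  [/\ forall p1 p2 : int_partition n, dominates p1 p2 ->
        one_accessible (partition_orbit K p1) (partition_orbit K p2),
      forall O1 O2 : set 'M[K]_n, nilpotent_orbit O1 -> nilpotent_orbit O2 ->
        (accessible O1 O2 <-> one_accessible O1 O2),
      partial_order_on (@nilpotent_orbit K n) (fun O2 O1 => accessible O1 O2),
      forall O1 O2 : set 'M[K]_n, nilpotent_orbit O1 -> nilpotent_orbit O2 ->
        (accessible O1 O2 <-> zariski_closure O2 `<=` zariski_closure O1)
    & forall p1 p2 : int_partition n,
        accessible (partition_orbit K p1) (partition_orbit K p2) <->
        dominates p1 p2].
Proof.
split.
- exact: dominates_one_accessible.
- move=> O1 O2 nil1 nil2; split=> [acc12|]; last exact: one_accessible_accessible.
  by apply: closure_one_accessible => //; apply: accessible_closure.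
- split=> [O nilO|O1 O2 _ _ acc21 acc12|O1 O2 O3 _ _ _ acc21 acc32].
  + exact: accessible_refl.
  + exact: accessible_anti.
  + exact: accessible_trans acc32 acc21.
- move=> O1 O2 nil1 nil2; split=> [|sub21]; first exact: accessible_closure.
  by apply: one_accessible_accessible => //; apply: closure_one_accessible.
move=> p1 p2; split=> [|p12]; first exact: accessible_dominates.
apply: one_accessible_accessible; try exact: nilpotent_partition_orbit.
exact: dominates_one_accessible.
Qed.
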